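(* Let $m,k,n\in\mathbb{N}$, let $P\subseteq\mathbb{Z}^m$, and let $\mathcal{E}_i,\mathcal{D}_i:\mathcal{I}_P\to\mathcal{I}_P$, $i\in\{0,1,\dots,n\}$, be two sequences of operations satisfying (A1), (A2) and (A3). Let $g\in\mathcal{I}_P$ be a binary image and let $A\subseteq\{0,\pm1,\dots,\pm n\}^k$ be a set of alternating sequences. Then the family $\{X^{\mathcal{E},\mathcal{D}}_{\mathbf{i}}(g)\}_{\mathbf{i}\in A}$ is a $k$-parameter filtration; that is, for all $\mathbf{u},\mathbf{v}\in A$ with $\mathbf{u}\le\mathbf{v}$ one has $X^{\mathcal{E},\mathcal{D}}_{\mathbf{u}}(g)\subseteq X^{\mathcal{E},\mathcal{D}}_{\mathbf{v}}(g)$.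
   Context: Images: for a set $P\subseteq\mathbb{Z}^m$, an image on $P$ is a function $g:P\to\mathbb{R}_{\ge0}$; $\mathcal{I}_P$ denotes the set of all images on $P$. An image is binary if it takes values in $\{0,1\}$. For $f,g\in\mathcal{I}_P$, write $f\le g$ iff $f(\mathbf{p})\le g(\mathbf{p})$ for all $\mathbf{p}\in P$. Assumptions on the operations $\mathcal{E}_i,\mathcal{D}_i:\mathcal{I}_P\to\mathcal{I}_P$: for all $f,g\in\mathcal{I}_P$ and all $i,j\in\{0,1,\dots,n\}$, (A1) if $f\le g$, then $\mathcal{E}_i(f)\le\mathcal{E}_i(g)$ and $\mathcal{D}_i(f)\le\mathcal{D}_i(g)$; (A2) if $i\le j$, then $\mathcal{E}_i(g)\ge\mathcal{E}_j(g)$ and $\mathcal{D}_i(g)\le\mathcal{D}_j(g)$; (A3) $\mathcal{D}_0(g)=\mathcal{E}_0(g)=g$. For $i\in\{0,\pm1,\dots,\pm n\}$ define $M_i^{\mathcal{E},\mathcal{D}}:\mathcal{I}_P\to\mathcal{I}_P$ by $M_i^{\mathcal{E},\mathcal{D}}(g)=\mathcal{E}_i(g)$ if $i\ge0$ and $M_i^{\mathcal{E},\mathcal{D}}(g)=\mathcal{D}_{|i|}(g)$ if $i<0$. For $\mathbf{i}=(i_1,\dots,i_k)\in\{0,\pm1,\dots,\pm n\}^k$ define $$M^{\mathcal{E},\mathcal{D}}_{\mathbf{i}}=M^{\mathcal{E},\mathcal{D}}_{i_1}\circ M^{\mathcal{E},\mathcal{D}}_{i_2}\circ\cdots\circ M^{\mathcal{E},\mathcal{D}}_{i_k},\qquad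 X^{\mathcal{E},\mathcal{D}}_{\mathbf{i}}(g)=\{\mathbf{x}\in P : M^{\mathcal{E},\mathcal{D}}_{\mathbf{i}}(g)(\mathbf{x})=0\}.$$ A sequence $\mathbf{i}=(i_1,\dots,i_k)\in\{0,\pm1,\dots,\pm n\}^k$ is alternating if $i_l\cdot i_{l+1}\le0$ for all $l\in\{1,\dots,k-1\}$; a set of alternating sequences is a subset of $\{0,\pm1,\dots,\pm n\}^k$ all of whose elements are alternating. Partial order on $\mathbb{Z}^k$: $\mathbf{u}\le\mathbf{v}$ iff $u_i\le v_i$ for all $i$. A family of sets $\{S_{\mathbf{i}}\}_{\mathbf{i}\in A}$ with $A\subseteq\mathbb{Z}^k$ is a $k$-parameter filtration (multifiltration) if $S_{\mathbf{u}}\subseteq S_{\mathbf{v}}$ whenever $\mathbf{u},\mathbf{v}\in A$ and $\mathbf{u}\le\mathbf{v}$. *)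

(* Defs.v *)
From mathcomp Require Import all_boot all_order all_algebra.
From mathcomp Require Import interval_inference.
From mathcomp Require Import boolp classical_sets reals.

Set Implicit Arguments.
Unset Strict Implicit.
Unset Printing Implicit Defensive.

Import Order.TTheory GRing.Theory Num.Theory.

Local Open Scope classical_set_scope.
Local Open Scope ring_scope.

(* Images are compared by [(f <= g)%O], the pointwise order that boolp puts on
   function types. *)
Definition img (R : realType) (m : nat) (P : set (m.-tuple int)) : Type :=
  P -> {nonneg R}.

Definition binary (R : realType) (m : nat) (P : set (m.-tuple int))
    (g : img R P) : Prop :=
  forall p : P, (g p)%:num = 0 \/ (g p)%:num = 1.

(* For [`|i| > n] the junk index [inord `|i|] is [ord0]; only integers with
   [`|i| <= n] are ever meant. *)
Definition Mop (R : realType) (m n : nat) (P : set (m.-tuple int))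
    (E D : 'I_n.+1 -> img R P -> img R P) (i : int) : img R P -> img R P :=
  if 0 <= i then E (inord `|i|%N) else D (inord `|i|%N).

(* M_(i_1, ..., i_k) = M_(i_1) \o ... \o M_(i_k), so [M_(i_k)] acts first. *)
Definition Mseq (R : realType) (m n k : nat) (P : set (m.-tuple int))
    (E D : 'I_n.+1 -> img R P -> img R P) (u : k.-tuple int) :
    img R P -> img R P :=
  foldr (fun i F => Mop E D i \o F) id u.

Definition Xset (R : realType) (m n k : nat) (P : set (m.-tuple int))
    (E D : 'I_n.+1 -> img R P -> img R P) (g : img R P) (u : k.-tuple int) :
    set P :=
  [set x : P | (Mseq E D u g x)%:num = 0].

Definition index_range (n k : nat) : set (k.-tuple int) :=
  [set u | forall l : 'I_k, (`|tnth u l| <= n)%N].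

Arguments index_range : clear implicits.

Definition alternating (k : nat) (u : k.-tuple int) : Prop :=
  forall l : nat, (l.+1 < k)%N -> u`_l * u`_l.+1 <= 0.

(* [k.-tupleprod int] is [k.-tuple int] with the componentwise order. *)
Definition multifiltration (T : Type) (k : nat) (A : set (k.-tupleprod int))
    (S : k.-tupleprod int -> set T) : Prop :=
  forall u v : k.-tupleprod int,
    A u -> A v -> (u <= v)%O -> S u `<=` S v.

(* Main.v *)
(* M_i is monotone in the image and antitone in the index: across the sign
   change one has E_j g <= E_0 g = g = D_0 g <= D_i g. Hence u <= v gives
   M_v g <= M_u g, and a nonnegative image below M_u g vanishes wherever M_u g
   does. *)
Require Import Defs.
From mathcomp Require Import all_boot all_order all_algebra.
From mathcomp Require Import interval_inference.
From mathcomp Require Import boolp classical_sets reals.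

Set Implicit Arguments.
Unset Strict Implicit.
Unset Printing Implicit Defensive.

Import Order.TTheory GRing.Theory Num.Theory.

Local Open Scope classical_set_scope.
Local Open Scope ring_scope.

Lemma Mop_monotone (R : realType) (m n : nat) (P : set (m.-tuple int))
    (E D : 'I_n.+1 -> img R P -> img R P)
    (A1 : forall (f g : img R P) (i : 'I_n.+1), (f <= g)%O ->
       (E i f <= E i g)%O /\ (D i f <= D i g)%O)
    (i : int) (f g : img R P) :
  (f <= g)%O -> (Mop E D i f <= Mop E D i g)%O.
Proof. by rewrite /Mop => /A1 EDfg; case: ifP => _; case: (EDfg (inord `|i|%N)). Qed.

(** The bounds on [i] and [j] keep [inord] faithful to the absolute values; an out-of-range index
    would collapse to [ord0] and could reverse the comparison. *)
Lemma Mop_antitone (R : realType) (m n : nat) (P : set (m.-tuple int))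
    (E D : 'I_n.+1 -> img R P -> img R P)
    (A2 : forall (g : img R P) (i j : 'I_n.+1), (i <= j)%N ->
       (E j g <= E i g)%O /\ (D i g <= D j g)%O)
    (A3 : forall g : img R P, D ord0 g = g /\ E ord0 g = g)
    (i j : int) (g : img R P) :
  (`|i| <= n)%N -> (`|j| <= n)%N -> i <= j ->
  (Mop E D j g <= Mop E D i g)%O.
Proof.
move=> in_ jn; rewrite /Mop; case: (leP 0 i) => i0; case: (leP 0 j) => j0 ij.
- have le_abs : (@inord n `|i| <= @inord n `|j|)%N.
    by rewrite !inordK ?ltnS // -lez_nat !gez0_abs.
  by case: (A2 g _ _ le_abs).
(* Impossible signs: [0 <= i <= j < 0]. *)
- by have := lt_le_trans j0 (le_trans i0 ij); rewrite ltxx.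
- have [Dg Eg] := A3 g.
  have [Ejg _] := A2 g ord0 (inord `|j|) (leq0n _).
  have [_ Dig] := A2 g ord0 (inord `|i|) (leq0n _).
  by rewrite Eg in Ejg; rewrite Dg in Dig; exact: le_trans Ejg Dig.
(* Both indices are negative, so absolute values reverse the order; this matches [D], which grows
   with its index where [E] shrinks. *)
- have le_abs : (@inord n `|j| <= @inord n `|i|)%N.
    by rewrite !inordK ?ltnS // -lez_nat !ltz0_abs // lerN2.
  by case: (A2 g _ _ le_abs).
Qed.

(** Phrased for plain sequences of equal size, so that one can induct on both at once, which tuples
    of a fixed length [k] would hinder. *)
Lemma foldr_Mop_antitone (R : realType) (m n : nat) (P : set (m.-tuple int))
    (E D : 'I_n.+1 -> img R P -> img R P)
    (A1 : forall (f g : img R P) (i : 'I_n.+1), (f <= g)%O ->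
       (E i f <= E i g)%O /\ (D i f <= D i g)%O)
    (A2 : forall (g : img R P) (i j : 'I_n.+1), (i <= j)%N ->
       (E j g <= E i g)%O /\ (D i g <= D j g)%O)
    (A3 : forall g : img R P, D ord0 g = g /\ E ord0 g = g)
    (s t : seq int) (g : img R P) :
  size s = size t ->
  all (fun i : int => `|i| <= n)%N s -> all (fun i : int => `|i| <= n)%N t ->
  (forall l : nat, (l < size s)%N -> s`_l <= t`_l) ->
  (foldr (fun i F => Mop E D i \o F) id t g
     <= foldr (fun i F => Mop E D i \o F) id s g)%O.
Proof.
elim: s t => [|i s IHs] [|j t] //= [size_st] /andP[in_ sn] /andP[jn tn] st.
(* The intermediate image has the head of [t] and the tail of [s]: first the inner image changes
   under a fixed outer operation, then the outer index changes on a fixed image. *)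
apply: (@le_trans _ _ (Mop E D j (foldr (fun i F => Mop E D i \o F) id s g))).
  apply: (Mop_monotone A1); apply: IHs => // l ls; exact: (st l.+1).
exact: (Mop_antitone A2 A3) (st 0 isT).
Qed.

Theorem theorem1 (R : realType) (m k n : nat) (P : set (m.-tuple int))
    (E D : 'I_n.+1 -> img R P -> img R P)
    (A1 : forall (f g : img R P) (i : 'I_n.+1), (f <= g)%O ->
       (E i f <= E i g)%O /\ (D i f <= D i g)%O)
    (A2 : forall (g : img R P) (i j : 'I_n.+1), (i <= j)%N ->
       (E j g <= E i g)%O /\ (D i g <= D j g)%O)
    (A3 : forall g : img R P, D ord0 g = g /\ E ord0 g = g)
    (g : img R P) (hg : binary g)
    (A : set (k.-tuple int))
    (A_range : A `<=` index_range n k)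
    (A_alt : forall u : k.-tuple int, A u -> alternating u) :
  multifiltration A (Xset E D g).
Proof.
have in_range u : A u -> all (fun i : int => `|i| <= n)%N u.
  by move=> /A_range un; apply/all_tnthP.
move=> u v Au Av; rewrite leEtprod => /forallP uv x; rewrite /Xset /= => ux0.
have /lefP/(_ x) : (Mseq E D v g <= Mseq E D u g)%O.
  apply: (foldr_Mop_antitone A1 A2 A3); rewrite ?in_range ?size_tuple // => l lk.
  by have := uv (Ordinal lk); rewrite !(tnth_nth 0).
rewrite -num_le /= ux0 => vx_le0.
(* The reverse inequality comes from the type [{nonneg R}] of the pixel values. *)
by apply/eqP; rewrite eq_le vx_le0 /=.
Qed.
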